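(* For any positive integers $k$ and $p_1, p_2, \ldots, p_k$, $$gr_{k}^{*}(K_{3}: K_{p_1}, K_{p_2}, \ldots, K_{p_k})=gr_{k}(K_{3}: K_{p_1}, K_{p_2}, \ldots, K_{p_k})-1.$$
   Context: All graphs are finite and simple. A $k$-edge-coloring uses colors from $[k]=\{1,\ldots,k\}$. A subgraph is monochromatic if all its edges have the same color and rainbow if no two of its edges have the same color. For graphs $H_1,\ldots,H_k$, the Gallai-Ramsey number $gr_k(K_3: H_1,\ldots,H_k)$ is the smallest integer $n$ such that every $k$-edge-colored $K_n$ contains either a rainbow $K_3$ or, for some $i\in[k]$, a copy of $H_i$ all of whose edges have color $i$. For $n=gr_k(K_3:H_1,\ldots,H_k)$ and an integer $s$ with $0\le s\le n-1$, $K_{n-1}\sqcup K_{1,s}$ denotes the graph obtained from $K_{n-1}$ by adding a new vertex $v$ and $s$ edges joining $v$ to $s$ vertices of $K_{n-1}$. The star-critical Gallai-Ramsey number $gr_k^{*}(K_3: H_1,\ldots,H_k)$ is the smallest integer $s$ such that every $k$-edge-colored $K_{n-1}\sqcup K_{1,s}$ contains either a rainbow $K_3$ or, for some $i\in[k]$, a copy of $H_i$ all of whose edges have color $i$. *)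

(* Defs.v *)
From mathcomp Require Import all_boot.

Set Implicit Arguments.
Unset Strict Implicit.
Unset Printing Implicit Defensive.

Record sgraph := SGraph {
  vertex :> finType;
  edges : {set {set vertex}};
  edges_card2 : forall e, e \in edges -> #|e| = 2 }.

Section Complete.
Variable n : nat.

Definition complete_edges : {set {set 'I_n}} := [set e : {set 'I_n} | #|e| == 2].

Fact complete_card2 (e : {set 'I_n}) : e \in complete_edges -> #|e| = 2.
Proof. by rewrite inE => /eqP. Qed.

Definition complete : sgraph := SGraph complete_card2.

End Complete.

Section CompleteStar.
Variables m s : nat.

Definition complete_star_edges : {set {set option 'I_m}} :=
  [set Some @: (e : {set 'I_m}) | e in complete_edges m]
  :|: [set [set None; Some i] | i : 'I_m & i < s].

Fact complete_star_card2 (e : {set option 'I_m}) : e \in complete_star_edges -> #|e| = 2.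
Proof.
rewrite inE => /orP[] /imsetP[x]; last by move=> _ ->; rewrite cards2.
by rewrite inE => /eqP cx ->; rewrite card_imset // => ? ? [].
Qed.

(* K_m with a new vertex [None] joined to the [s] vertices 0, ..., s-1; which  *)
(* [s] vertices are chosen is immaterial up to isomorphism. Meaningful for     *)
(* [s <= m].                                                                   *)
Definition complete_star : sgraph := SGraph complete_star_card2.

End CompleteStar.

(* [f] exhibits a (not necessarily induced) copy of [H] inside [G]. *)
Definition is_copy (H G : sgraph) (f : {ffun H -> G}) : bool :=
  injectiveb f && [forall e in edges H, f @: e \in edges G].

(* An edge-coloring of [G] is a function on all vertex sets of [G], of which   *)
(* only the values on [edges G] matter: for k > 0 every coloring of the edges  *)
(* extends to such a function. Colors are 0, ..., k-1 instead of 1, ..., k.    *)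
Definition coloring (k : nat) (G : sgraph) := {ffun {set G} -> 'I_k}.

Definition has_mono_copy k (H G : sgraph) (c : coloring k G) (i : 'I_k) :=
  [exists f : {ffun H -> G},
     is_copy f && [forall e in edges H, c (f @: e) == i]].

Definition has_rainbow_copy k (H G : sgraph) (c : coloring k G) :=
  [exists f : {ffun H -> G},
     is_copy f && [forall e in edges H, forall e' in edges H,
                     (e != e') ==> (c (f @: e) != c (f @: e'))]].

Definition gallai_arrows k (G : sgraph) (H : 'I_k -> sgraph) : bool :=
  [forall c : coloring k G,
     has_rainbow_copy (complete 3) c || [exists i, has_mono_copy (H i) c i]].

Lemma ramsey k (p : 'I_k -> nat) :
  exists n, forall (T : finType) (c : {set T} -> 'I_k) (A : {set T}),
    n <= #|A| -> exists i, exists2 B : {set T},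
      B \subset A /\ #|B| = p i &
      forall e : {set T}, e \subset B -> #|e| = 2 -> c e = i.
Proof.
have [m] := ubnP (\sum_i p i); elim: m p => // m IHm p lt_p_m.
have [/existsP[i /eqP pi0] | /existsPn p_neq0] := boolP [exists i, p i == 0].
  exists 0 => T c A _; exists i; exists set0.
    by rewrite sub0set cards0 pi0.
  by move=> e; rewrite subset0 => /eqP->; rewrite cards0.
pose q i j := if j == i then (p j).-1 else p j.
have lt_q i : \sum_j q i j < m.
  rewrite -ltnS; apply: leq_trans lt_p_m; rewrite ltnS.
  rewrite (bigD1 i) //= [in leqRHS](bigD1 i) //= /q eqxx.
  rewrite -addSn prednK ?lt0n //; apply: leq_add => //.
  by apply: eq_leq; apply: eq_bigr => j /negPf->.
have {IHm lt_q} /fin_all_exists[N hN] i := IHm (q i) (lt_q i).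
exists (\sum_i N i).+2 => T c A leA.
have [x xA] : exists x, x \in A by apply/card_gt0P; apply: leq_trans leA.
pose D i := [set y in A :\ x | c [set x; y] == i].
have [i leD] : exists i, N i <= #|D i|.
  apply/existsP; apply: contraLR leA; rewrite negb_exists => /forallP ltD.
  rewrite -ltnNge (cardsD1 x) xA add1n !ltnS.
  rewrite -sum1_card (partition_big (fun y => c [set x; y]) predT) //=.
  apply: leq_sum => i _; have := ltD i; rewrite -ltnNge => /ltnW.
  by apply: leq_trans; rewrite -sum1_card; apply: eq_leq; apply: eq_bigl => y;
     rewrite !inE.
have [j [B [BD cB] hB]] := hN i T c (D i) leD.
have BA : B \subset A.
  by apply: subset_trans BD _; apply/subsetP=> y; rewrite !inE => /andP[/andP[]].
have [eji | neji] := eqVneq j i; last first.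
  by exists j, B => //; rewrite cB /q (negPf neji).
exists i; subst j; exists (x |: B).
  rewrite subUset sub1set xA BA; split=> //.
  have -> : #|x |: B| = #|B|.+1.
    rewrite cardsU1; case: (boolP (x \in B)) => // /(subsetP BD).
    by rewrite !inE eqxx.
  by rewrite cB /q eqxx prednK // lt0n.
move=> e eB /eqP/cards2P[y [z [neyz def_e]]]; subst e.
have [yB zB] : y \in x |: B /\ z \in x |: B.
  by split; apply: (subsetP eB); rewrite !inE eqxx ?orbT.
have star u : u \in B -> c [set x; u] = i.
  by move/(subsetP BD); rewrite inE => /andP[_ /eqP].
move: yB zB; rewrite !in_setU1.
case/orP=> [/eqP eyx | yB]; case/orP=> [/eqP ezx | zB].
- by rewrite eyx ezx eqxx in neyz.
- by rewrite eyx star.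
- by rewrite ezx setUC star.
- by apply: hB; [rewrite subUset !sub1set yB zB | rewrite cards2 neyz].
Qed.

Lemma gallai_arrows_hom k (K G : sgraph) (H : 'I_k -> sgraph)
    (g : {ffun K -> G}) :
  is_copy g -> gallai_arrows K H -> gallai_arrows G H.
Proof.
move=> /andP[/injectiveP g_inj /forall_inP gE] /forallP arr; apply/forallP=> c.
have comp_im (L : sgraph) (f : {ffun L -> K}) (e : {set L}) :
    [ffun x => g (f x)] @: e = g @: (f @: e).
  by rewrite -imset_comp; apply: eq_imset => x; rewrite /= ffunE.
have comp_copy (L : sgraph) (f : {ffun L -> K}) : is_copy f ->
    is_copy ([ffun x => g (f x)] : {ffun L -> G}).
  move=> /andP[/injectiveP f_inj /forall_inP fE]; apply/andP; split.
    by apply/injectiveP => x y; rewrite !ffunE => /g_inj/f_inj.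
  by apply/forall_inP => e /fE/gE; rewrite comp_im.
have /orP[] := arr [ffun e : {set K} => c (g @: e)].
  move=> /existsP[f /andP[fc /forall_inP fR]]; apply/orP; left.
  apply/existsP; exists [ffun x => g (f x)]; rewrite comp_copy ?andTb //.
  apply/forall_inP => e eE; apply/forall_inP => e' eE'.
  by have /forall_inP/(_ e' eE') := fR e eE; rewrite !ffunE !comp_im.
move=> /existsP[i /existsP[f /andP[fc /forall_inP fM]]]; apply/orP; right.
apply/existsP; exists i; apply/existsP; exists [ffun x => g (f x)].
rewrite comp_copy ?andTb //; apply/forall_inP => e eE.
by have := fM e eE; rewrite ffunE comp_im.
Qed.

Lemma gallai_ramsey_exists k (H : 'I_k -> sgraph) :
  exists n, gallai_arrows (complete n) H.
Proof.
have [n hn] := ramsey (fun i => #|H i|); exists n; apply/forallP => c.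
have [|i [B [_ cB] hB]] := hn _ c setT; first by rewrite cardsT card_ord.
apply/orP; right; apply/existsP; exists i; apply/existsP.
pose f : {ffun H i -> complete n} :=
  [ffun x => enum_val (cast_ord (esym cB) (enum_rank x))].
have f_inj : injective f.
  by move=> x y; rewrite !ffunE => /enum_val_inj/cast_ord_inj/enum_rank_inj.
have fB (e : {set H i}) : f @: e \subset B.
  by apply/subsetP => y /imsetP[x _ ->]; rewrite ffunE enum_valP.
have f2 e : e \in edges (H i) -> #|f @: e| = 2.
  by move=> /edges_card2; rewrite card_imset.
exists f; apply/andP; split; last first.
  by apply/forall_inP => e /f2 /(hB _ (fB e)) ->.
apply/andP; split; first exact/injectiveP.
by apply/forall_inP => e /f2 ce; rewrite inE ce.
Qed.

(* gr_k(K_3 : H_1, ..., H_k) *)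
Definition gallai_ramsey k (H : 'I_k -> sgraph) : nat :=
  ex_minn (gallai_ramsey_exists H).

(* Hence [gallai_ramsey _ - 1] is a genuine (untruncated) difference for       *)
(* complete graphs on at least one vertex.                                     *)
Lemma gallai_ramsey_gt0 k (p : 'I_k -> nat) :
  0 < k -> (forall i, 0 < p i) -> 0 < gallai_ramsey (fun i => complete (p i)).
Proof.
move=> k_gt0 p_gt0; rewrite /gallai_ramsey; case: ex_minnP => -[|//] arr _.
have /forallP/(_ [ffun=> Ordinal k_gt0])/orP[] := arr.
  by move=> /existsP[f _]; case: (f ord0).
by move=> /existsP[i /existsP[f _]]; case: (f (Ordinal (p_gt0 i))).
Qed.

Lemma complete_in_star n :
  exists g : {ffun complete n -> complete_star n.-1 n.-1}, is_copy g.
Proof.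
pose g (x : 'I_n) : option 'I_n.-1 := insub (val x).
have g_inj : injective g.
  move=> x y; rewrite /g; case: insubP => [u _ vu|nx].
    by case: insubP => // v _ vv [euv]; apply: val_inj; rewrite -vu -vv euv.
  case: insubP => // ny _; apply: val_inj => /=.
  have last (z : 'I_n) : ~~ (z < n.-1) -> z = n.-1 :> nat.
    rewrite -leqNgt => le_z; apply/eqP; rewrite eqn_leq le_z andbT.
    by rewrite -ltnS (ltn_predK (ltn_ord z)).
  by rewrite (last _ nx) (last _ ny).
exists [ffun x => g x]; apply/andP; split.
  by apply/injectiveP => x y; rewrite !ffunE => /g_inj.
apply/forall_inP => e; rewrite inE => /cards2P[x [y [ne_xy ->]]].
rewrite imsetU !imset_set1 !ffunE.
have: g x != g y by rewrite (inj_eq g_inj).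
case: (g x) (g y) => [i|] [j|] //= ne_ij; rewrite inE; apply/orP.
- left; apply/imsetP; exists [set i; j]; last by rewrite imsetU !imset_set1.
  by rewrite inE cards2 (_ : i != j).
- by right; apply/imsetP; exists i; rewrite ?inE // setUC.
- by right; apply/imsetP; exists j; rewrite ?inE.
Qed.

Definition star_critical_pred k (H : 'I_k -> sgraph) : pred nat :=
  let n := gallai_ramsey H in
  [pred s | (s <= n.-1) && gallai_arrows (complete_star n.-1 s) H].

Lemma star_critical_exists k (H : 'I_k -> sgraph) :
  exists s, star_critical_pred H s.
Proof.
exists (gallai_ramsey H).-1; apply/andP; split=> //.
have [g g_copy] := complete_in_star (gallai_ramsey H).
apply: gallai_arrows_hom g_copy _.
by rewrite /gallai_ramsey; case: ex_minnP.
Qed.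

(* gr_k^*(K_3 : H_1, ..., H_k) *)
Definition star_critical_gallai_ramsey k (H : 'I_k -> sgraph) : nat :=
  ex_minn (star_critical_exists H).

(* Main.v *)
(* If [s < n - 1], the extra vertex of [K_(n-1)] with [s] added edges misses   *)
(* some vertex [w], and folding it onto [w] is a graph homomorphism onto       *)
(* [K_(n-1)]. Pull a critical coloring of [K_(n-1)] back along it: complete    *)
(* graphs are mapped injectively by homomorphisms, so a rainbow triangle or a  *)
(* monochromatic clique upstairs would yield one in [K_(n-1)].                 *)
Require Import Defs.
From mathcomp Require Import all_boot.

(** With n the Gallai-Ramsey number, s <= n - 1 is built into [star_critical_pred]. If s < n - 1,
    [complete_star_hom] folds the star graph onto K_(n-1), and [gallai_arrows_complete_hom] pushes
    arrowing forward, against the minimality of n. *)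

Definition is_hom (G K : sgraph) (g : G -> K) :=
  forall e : {set G}, e \in edges G -> g @: e \in edges K.

Lemma imset_ffun_comp (L G K : finType) (g : G -> K) (f : {ffun L -> G})
    (e : {set L}) :
  [ffun x => g (f x)] @: e = g @: (f @: e).
Proof.
by rewrite -imset_comp; apply: eq_imset => x; rewrite /= ffunE.
Qed.

(** Any two vertices of the clique are adjacent; identifying them would give an edge with a
    one-element image. *)
Lemma is_copy_complete_hom (G K : sgraph) (g : G -> K) n
    (f : {ffun complete n -> G}) :
  is_hom G K g -> is_copy f ->
  is_copy ([ffun x => g (f x)] : {ffun complete n -> K}).
Proof.
move=> g_hom /andP[_ /forall_inP fE]; apply/andP; split; last first.
  by apply/forall_inP => e /fE /g_hom; rewrite imset_ffun_comp.
apply/injectiveP => x y; rewrite !ffunE => eq_g.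
apply/eqP; apply: contraT => ne_xy.
have /fE /g_hom /edges_card2 : [set x; y] \in edges (complete n).
  by rewrite inE cards2 ne_xy.
by rewrite !imsetU !imset_set1 eq_g setUid cards1.
Qed.

Lemma gallai_arrows_complete_hom k (G K : sgraph) (p : 'I_k -> nat)
    (g : G -> K) :
  is_hom G K g -> gallai_arrows G (fun i => complete (p i)) ->
  gallai_arrows K (fun i => complete (p i)).
Proof.
move=> g_hom /forallP arr; apply/forallP => c.
have /orP[] := arr [ffun e : {set G} => c (g @: e)].
  move=> /existsP[f /andP[fc /forall_inP fR]]; apply/orP; left.
  apply/existsP; exists [ffun x => g (f x)].
  rewrite is_copy_complete_hom ?andTb //.
  apply/forall_inP => e eE; apply/forall_inP => e' e'E.
  by have /forall_inP/(_ e' e'E) := fR e eE; rewrite !ffunE !imset_ffun_comp.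
move=> /existsP[i /existsP[f /andP[fc /forall_inP fM]]]; apply/orP; right.
apply/existsP; exists i; apply/existsP; exists [ffun x => g (f x)].
rewrite is_copy_complete_hom ?andTb //; apply/forall_inP => e eE.
by have := fM e eE; rewrite ffunE imset_ffun_comp.
Qed.

(** [odflt w] sends the new vertex [None] to [w]; as [s <= w], these two are not adjacent, so no
    edge collapses. *)
Lemma complete_star_hom m s (w : 'I_m) :
  s <= w -> is_hom (complete_star m s) (complete m) (odflt w).
Proof.
move=> le_sw e; rewrite !inE => /orP[] /imsetP[].
  move=> d; rewrite inE => cd ->.
  by rewrite -imset_comp (eq_imset (g := id)) ?imset_id.
move=> i; rewrite inE => lt_is ->.
have ne_wi : w != i by apply: contraTneq (leq_trans lt_is le_sw) => ->; rewrite ltnn.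
by rewrite imsetU !imset_set1 cards2 /= ne_wi.
Qed.

Theorem theorem3p1 (k : nat) (p : 'I_k -> nat)
    (k_gt0 : 0 < k) (p_gt0 : forall i : 'I_k, 0 < p i) :
  star_critical_gallai_ramsey (fun i : 'I_k => complete (p i))
  = gallai_ramsey (fun i : 'I_k => complete (p i)) - 1.
Proof.
rewrite /star_critical_gallai_ramsey subn1.
case: ex_minnP => s /andP[le_s arr] _.
apply/eqP; rewrite eqn_leq le_s leqNgt /=; apply/negP => lt_s.
(* The last vertex of K_(n-1), with index n - 2, is missed by the star. *)
have lt_w : (gallai_ramsey (fun i => complete (p i))).-2
            < (gallai_ramsey (fun i => complete (p i))).-1.
  by rewrite ltn_predL (leq_ltn_trans _ lt_s).
have le_sw : s <= Ordinal lt_w by rewrite -ltnS (ltn_predK lt_s).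
have := gallai_arrows_complete_hom _ _ _ _ _ (complete_star_hom _ _ _ le_sw) arr.
move: (gallai_ramsey_gt0 k_gt0 p_gt0); rewrite /gallai_ramsey.
by case: ex_minnP => -[|n] //= _ n_min _ /n_min; rewrite ltnn.
Qed.
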